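(* For every fixed positive integer $r$, $\chi_{CF}(\mathsf{D}_r^2(n))=\Theta(n^{1/r})$ as $n\to\infty$.
   Context: A conflict-free coloring (CF-coloring) of a hypergraph $(V,\mathcal{E})$ is a map $\varphi$ on $V$ such that every nonempty hyperedge $e$ contains a vertex $x$ with $\varphi(y)\ne\varphi(x)$ for all $y\in e\setminus\{x\}$; $\chi_{CF}(H)$ is the least number of colors in a CF-coloring of $H$. $C_{[n]}$ is the cycle on vertex set $[n]$ with edges $\{i,i+1\}$ (indices mod $n$). $\mathsf{D}_r^2(n)$ is the $2r$-uniform hypergraph on $[n]$ whose hyperedges are the sets $V(P_1)\cup V(P_2)$ where $P_1,P_2$ are vertex-disjoint paths on $r$ vertices in $C_{[n]}$. *)

(* Defs.v *)
From mathcomp Require Import all_boot.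

Set Implicit Arguments.
Unset Strict Implicit.
Unset Printing Implicit Defensive.

(* A hypergraph on the finite vertex set V is given by its set of hyperedges
   E : {set {set V}}. *)

Definition cf_coloring (V : finType) (C : eqType) (E : {set {set V}})
    (phi : V -> C) : bool :=
  [forall e in E, (e != set0) ==>
     [exists x in e, [forall y in e :\ x, phi y != phi x]]].

Definition cf_colorable (V : finType) (E : {set {set V}}) (k : nat) : bool :=
  [exists phi : {ffun V -> 'I_k}, cf_coloring E phi].

Lemma cf_colorable_ex (V : finType) (E : {set {set V}}) :
  exists k, cf_colorable E k.
Proof.
exists #|V|; apply/existsP; exists [ffun x => enum_rank x].
apply/'forall_implyP => e _; apply/implyP => /set0Pn[x xe].
apply/'exists_andP; exists x; split=> //.
apply/'forall_implyP => y; rewrite !inE => /andP[yx _].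
by rewrite !ffunE (inj_eq enum_rank_inj).
Qed.

Definition chi_CF (V : finType) (E : {set {set V}}) : nat :=
  ex_minn (cf_colorable_ex E).

(* The cycle on n vertices; the vertex set {1, ..., n} is represented by
   'I_n = {0, ..., n - 1}, on which ordS is the successor modulo n. *)
Definition cycle_edges (n : nat) : {set {set 'I_n}} :=
  [set [set i; ordS i] | i : 'I_n].

Definition path_vertex_sets (V : finType) (G : {set {set V}}) (r : nat) :
    {set {set V}} :=
  [set [set x in val p] | p : r.-tuple V &
     uniq p && sorted (fun x y => [set x; y] \in G) p].

Definition D2 (r n : nat) : {set {set 'I_n}} :=
  [set A :|: B | A in path_vertex_sets (cycle_edges n) r,
                 B in path_vertex_sets (cycle_edges n) r & [disjoint A & B]].

(* Main.v *)
Require Import Defs.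
From mathcomp Require Import all_boot zify.

(** Lower bound: if two disjoint blocks of [r] consecutive vertices carried the same
    sequence of colors, every color of their union would be repeated; hence the
    [n %/ r] consecutive blocks have distinct color sequences and [n %/ r <= k ^ r].

    Upper bound: when [n <= q ^ r], write the block number [i %/ r] of a vertex [i]
    in base [q], color [i] by its residue modulo [2 * r] together with the digit of
    rank [i %% r] of its block number, and give vertex [0] a color of its own, so that
    only paths not passing through [0] matter. Such a path is an interval,
    its colors are pairwise distinct, and its set of colors determines its starting
    point; so of two disjoint paths, the first has a color missing in the second. *)

(** * Blocks of consecutive vertices and the lower bound on colors *)

Lemma set2_cycle_edgeE (n : nat) (x y : 'I_n) :
  ([set x; y] \in cycle_edges n) = (y == ordS x) || (x == ordS y).
Proof.
apply/imsetP/orP => [[i _ exy]|[/eqP->|/eqP->]]; first last.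
- by exists y; rewrite // setUC.
- by exists x.
have := set22 i (ordS i); have := set21 i (ordS i); rewrite -exy.
move=> /set2P[ix|iy] /set2P[Six|Siy].
(* Here [ordS i = i], so the edge is a singleton and [x = y]. *)
- by have := set22 x y; rewrite exy Six ix setUid => /set1P->; left; rewrite -{2}ix Six.
- by left; rewrite -Siy ix.
- by right; rewrite -Six iy.
- by have := set21 x y; rewrite exy Siy iy setUid => /set1P->; left; rewrite -{2}iy Siy.
Qed.

Lemma block_lt (n r : nat) (j : 'I_(n %/ r)) (t : 'I_r) : j * r + t < n.
Proof.
have h := ltn_ord j.
have := ltn_ord t; have := leq_trunc_div n r.
have : (j.+1 * r <= n %/ r * r) by rewrite leq_mul2r h orbT.
lia.
Qed.

Definition block {n r : nat} (j : 'I_(n %/ r)) (t : 'I_r) : 'I_n :=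
  Ordinal (block_lt n r j t).

Lemma block_inj2 {n r : nat} (j j' : 'I_(n %/ r)) (t t' : 'I_r) :
  block j t = block j' t' -> j = j'.
Proof.
case: r j j' t t' => [|r] j j' t t'; first by case: t.
move=> /(congr1 val) /= e; apply/val_inj => /=.
have := congr1 (divn^~ r.+1) e.
by rewrite /= !divnMDl // [t %/ _]divn_small // [t' %/ _]divn_small // !addn0.
Qed.

Lemma block_in_paths {n r : nat} (j : 'I_(n %/ r)) :
  [set block j t | t : 'I_r] \in path_vertex_sets (cycle_edges n) r.
Proof.
apply/imsetP; exists (map_tuple (block j) (ord_tuple r)).
  rewrite inE map_inj_uniq ?enum_uniq /=; last first.
    by move=> t t' /(congr1 val) /= /addnI /val_inj.
  rewrite sorted_map.
  have: sorted (fun x y => y == x.+1 :> nat) (map val (enum 'I_r)).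
    rewrite val_enum_ord; elim: r 0 {j} => // -[|r] //= IH m.
    by rewrite eqxx; apply: (IH m.+1).
  rewrite sorted_map; apply: sub_sorted => t t' /= /eqP tt'.
  rewrite set2_cycle_edgeE; apply/orP; left; apply/eqP/val_inj => /=.
  by rewrite -addnS -tt' modn_small //; apply: block_lt.
apply/setP => x; rewrite inE; apply/imsetP/mapP => -[t _ ->]; exists t => //.
by rewrite mem_enum.
Qed.

Lemma cf_colorable_D2_lower (r n k : nat) :
  cf_colorable (D2 r n) k -> n %/ r <= k ^ r.
Proof.
case/existsP => phi /forall_inP phiP.
pose f (j : 'I_(n %/ r)) := [ffun t : 'I_r => phi (block j t)].
suff /leq_card : injective f by rewrite card_ffun !card_ord.
move=> j j' fjj'; apply/eqP/negPn/negP => jj'.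
have ff t : phi (block j t) = phi (block j' t).
  by have := congr1 (fun g : {ffun _} => g t) fjj'; rewrite !ffunE.
pose A (j : 'I_(n %/ r)) := [set block j t | t : 'I_r].
(* As [n %/ 0 = 0], the existence of the block [j] forces [r] to be positive. *)
have r_gt0 : 0 < r.
  rewrite lt0n; apply: contraTneq (leq_ltn_trans (leq0n j) (ltn_ord j)) => ->.
  by rewrite divn0.
have AD2 : A j :|: A j' \in D2 r n.
  apply/imset2P; exists (A j) (A j'); rewrite ?block_in_paths //.
  rewrite inE block_in_paths /=.
  apply/pred0P => x /=; apply/negP => /andP[/imsetP[t _ ->] /imsetP[t' _]].
  by move/block_inj2 => e; rewrite e eqxx in jj'.
have A_neq0 : A j :|: A j' != set0.
  by apply/set0Pn; exists (block j (Ordinal r_gt0)); rewrite inE imset_f.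
have /exists_inP[x] := implyP (phiP _ AD2) A_neq0.
case/setUP => /imsetP[t _ ->] /forall_inP.
- move/(_ (block j' t)); rewrite ff eqxx => /(_ _)/negP; apply=> //.
  rewrite !inE imset_f ?orbT // andbT.
  by apply: contraNneq jj' => /block_inj2->.
- move/(_ (block j t)); rewrite ff eqxx => /(_ _)/negP; apply=> //.
  rewrite !inE imset_f // andbT.
  by apply: contraNneq jj' => /block_inj2->.
Qed.

(** * Base-[q] digits and the recovery of a window from its colors *)

Definition digit (q j b : nat) : nat := j %/ q ^ b %% q.

Lemma modn_expS (q a j : nat) :
  j %% q ^ a.+1 = digit q j a * q ^ a + j %% q ^ a.
Proof.
case: q => [|q]; first by rewrite exp0n // modn0 /digit modn0 -divn_eq.
have qa_gt0 : 0 < q.+1 ^ a by rewrite expn_gt0.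
rewrite [in LHS](divn_eq j (q.+1 ^ a)) {1}(divn_eq (j %/ q.+1 ^ a) q.+1) mulnDl.
rewrite -mulnA -expnS -addnA modnMDl modn_small //.
have := ltn_pmod j qa_gt0; have := ltn_pmod (j %/ q.+1 ^ a) (ltn0Sn q).
rewrite -/(digit q.+1 j a); set d := digit _ _ _; rewrite expnS.
move: (q.+1 ^ a) (j %% _) => Q m dq mQ.
suff : d.+1 * Q <= q.+1 * Q by lia.
by rewrite leq_mul2r dq orbT.
Qed.

Lemma eqmod_digitsP (q a j j' : nat) : 0 < q ->
  j = j' %[mod q ^ a] <-> (forall b, b < a -> digit q j b = digit q j' b).
Proof.
move=> q_gt0; elim: a => [|a IHa]; first by rewrite !modn1; split.
have qa_gt0 : 0 < q ^ a by rewrite expn_gt0 q_gt0.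
rewrite !modn_expS; split=> [e b|dE].
- have e1 : digit q j a = digit q j' a.
    have := congr1 (divn^~ (q ^ a)) e.
    by rewrite /= !divnMDl // !(divn_small (ltn_pmod _ _)) // !addn0.
  rewrite ltnS leq_eqVlt => /predU1P[->//|]; apply: (proj1 IHa).
  by move: e; rewrite e1 => /addnI.
- by rewrite dE // (proj2 IHa) // => b ba; apply/dE/ltnW.
Qed.

(* The component modulo [2 * r] locates the start of a window of length [r],
   which a component modulo [r] would not do. *)
Definition digit_color (r q i : nat) : nat * nat :=
  (i %% (2 * r), digit q (i %/ r) (i %% r)).

Lemma window_residue_inj (r m t t' : nat) : t < r -> t' < r ->
  m + t = m + t' %[mod 2 * r] -> t = t'.
Proof.
move=> tr t'r /eqP.
by rewrite eqn_modDl !modn_small; [move/eqP | lia | lia].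
Qed.

(* Between [m] and [m + r] the block number [j] may increase by one, at which point the
   low digits of [j] are replaced by those of [j.+1]; since the latter determine
   [j] modulo a power of [q], nothing is lost. *)
Lemma window_digits_inj (r q m m' : nat) : 0 < r -> 0 < q ->
    m < q ^ r -> m' < q ^ r -> m = m' %[mod r] ->
    (forall t, t < r -> digit q ((m + t) %/ r) ((m + t) %% r) =
                        digit q ((m' + t) %/ r) ((m' + t) %% r)) ->
  m = m'.
Proof.
move=> r_gt0 q_gt0 mq m'q mm' dE.
suff jj' : m %/ r = m' %/ r by rewrite (divn_eq m r) jj' mm' -divn_eq.
have jq : m %/ r < q ^ r by apply: leq_ltn_trans mq; apply: leq_div.
have j'q : m' %/ r < q ^ r by apply: leq_ltn_trans m'q; apply: leq_div.
(* Block numbers below [q ^ r] are determined by their [r] lowest digits. *)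
rewrite -(modn_small jq) -(modn_small j'q).
have := ltn_pmod m r_gt0.
have {}dE t : t < r ->
  digit q ((m %/ r * r + (m %% r + t)) %/ r) ((m %% r + t) %% r) =
  digit q ((m' %/ r * r + (m %% r + t)) %/ r) ((m %% r + t) %% r).
  move=> /dE; rewrite {1 2}(divn_eq m r) {1 2}(divn_eq m' r) -mm' -!addnA.
  by rewrite !modnMDl.
move: (m %/ r) (m' %/ r) (m %% r) dE {mm' mq m'q jq j'q} => j j' a dE ar.
(* Ranks from [a] on are read in block [j], ranks below [a] in block [j.+1]. *)
have hi b : a <= b < r -> digit q j b = digit q j' b.
  case/andP => ab br; have := dE (b - a); rewrite subnKC // modn_small //.
  by rewrite !divnMDl // divn_small // !addn0; apply; lia.
have lo b : b < a -> digit q j.+1 b = digit q j'.+1 b.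
  move=> ba; have := dE (r + b - a); rewrite subnKC; last by lia.
  rewrite modnDl modn_small; last by lia.
  rewrite !divnMDl // divnDl // divnn r_gt0 divn_small ?addn0 ?addn1; last by lia.
  by apply; lia.
have jj' : j = j' %[mod q ^ a].
  apply/eqP; rewrite -(eqn_modDr 1) !addn1; apply/eqP.
  exact/eqmod_digitsP.
apply/eqmod_digitsP => // b br.
have [ab|ba] := leqP a b; first by apply: hi; rewrite ab.
by move/eqmod_digitsP: jj' => ->.
Qed.

(** Only sets of colors are compared. The first and last vertices of the window of [m] must match
    residues [r.-1] apart in the window of [m'], which is possible in one way only; so vertices
    match in order and their digits agree. *)
Lemma digit_color_window_inj (r q m m' : nat) : 0 < r -> 0 < q ->
    m < q ^ r -> m' < q ^ r ->
    (forall t, t < r -> exists2 t', t' < r &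
       digit_color r q (m + t) = digit_color r q (m' + t')) ->
  m = m'.
Proof.
move=> r_gt0 q_gt0 mq m'q cE.
have mm' : m = m' %[mod 2 * r].
  have [t0 t0r c0] := cE 0 r_gt0.
  have [|t1 t1r c1] := cE r.-1; first by lia.
  (* Both offsets lie below [2 * r], so their congruence is an equality, and [t1 < r] gives
     [t0 = 0]. *)
  have s0 : t0 + r.-1 < 2 * r by lia.
  have s1 : t1 < 2 * r by lia.
  case: c0 c1 => e0 _ [e1 _]; rewrite addn0 in e0.
  have t1E : t0 + r.-1 = t1.
    apply/eqP; rewrite -(modn_small s0) -(modn_small s1) -(eqn_modDl m').
    by rewrite addnA -modnDml -e0 modnDml e1.
  suff t00 : t0 = 0 by rewrite e0 t00 addn0.
  by move: r_gt0 t1r; rewrite -t1E; clear; lia.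
apply: window_digits_inj mq m'q _ _ => //.
  by rewrite -(@modn_dvdm (2 * r) m r) ?dvdn_mull // mm' modn_dvdm // dvdn_mull.
move=> t tr; have [t' t'r [e ->]] := cE t tr.
suff -> : t = t' by [].
apply: (window_residue_inj r m') => //.
by rewrite -e -modnDml -mm' modnDml.
Qed.

(** * Paths avoiding vertex [0] as intervals *)

(** A repetition-free walk by unit steps cannot turn back. Recording that the start is an end of the
    interval carries the induction: a new first vertex can only extend it by one. *)
Lemma sorted_adj_interval (x : nat) (p : seq nat) :
    uniq (x :: p) -> path (fun x y => (y == x.+1) || (x == y.+1)) x p ->
  exists2 m, (x == m) || (x == m + size p) &
    forall z, (z \in x :: p) = (m <= z <= m + size p).
Proof.
elim: p x => [|y p IHp] x.
  by exists x => [|z]; rewrite ?eqxx // inE /=; lia.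
move=> /andP[xp yp] /= /andP[xy /(IHp _ yp)[m ym pE]].
rewrite pE in xp.
exists (minn x m) => [|z]; first by lia.
rewrite inE pE; lia.
Qed.

Lemma path_avoiding0_interval (r n : nat) (A : {set 'I_n}) : 0 < r ->
    A \in path_vertex_sets (cycle_edges n) r ->
    (forall x, x \in A -> 0 < val x) ->
  exists2 m, m + r <= n & forall x, (x \in A) = (m <= val x < m + r).
Proof.
move=> r_gt0 /imsetP[p]; rewrite inE => /andP[uniq_p sorted_p] ->.
rewrite -[val p]/(tval p) => A_gt0.
have {}A_gt0 x : x \in tval p -> 0 < val x by move=> xp; apply: A_gt0; rewrite inE.
have : size (tval p) = r by rewrite size_tuple.
case: (tval p) uniq_p sorted_p A_gt0 => [|x s] /= uniq_p path_p p_gt0 rE.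
  by rewrite -rE in r_gt0.
have pathE : path (fun a b => (b == a.+1) || (a == b.+1)) (val x) (map val s).
  (* The only wrap-around of the cycle lands on [0], which the path avoids. *)
  have S_gt0 (i : 'I_n) : 0 < val (ordS i) -> val (ordS i) = i.+1.
    rewrite /=; have := ltn_ord i; rewrite leq_eqVlt => /predU1P[->|].
      by rewrite modnn.
    by move=> /modn_small->.
  rewrite path_map; apply: sub_in_path (allss (x :: s)) path_p.
  move=> a b /p_gt0 a0 /p_gt0 b0; rewrite set2_cycle_edgeE.
  by case/orP => /eqP e; apply/orP; [left|right]; apply/eqP; rewrite /= e S_gt0 // -e.
have := @sorted_adj_interval (val x) (map val s).
rewrite -map_cons (map_inj_uniq val_inj) => /(_ uniq_p pathE)[m _ mE].
rewrite size_map in mE; exists m.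
  have : m + size s \in map val (x :: s) by rewrite mE leq_addr leqnn.
  by case/mapP => y _ ye; rewrite -rE addnS ye; apply: ltn_ord.
by move=> y; rewrite inE -(mem_map val_inj) mE -rE addnS ltnS.
Qed.

(** * The coloring for the upper bound *)

Lemma cf_coloring_colorable (V C : finType) (E : {set {set V}}) (phi : V -> C) :
  cf_coloring E phi -> cf_colorable E #|C|.
Proof.
move=> /forall_inP phiP; apply/existsP; exists [ffun x => enum_rank (phi x)].
apply/forall_inP => e eE; apply/implyP => e_neq0.
have /exists_inP[x xe /forall_inP xP] := implyP (phiP e eE) e_neq0.
apply/exists_inP; exists x => //; apply/forall_inP => y ye.
by rewrite !ffunE (inj_eq enum_rank_inj) xP.
Qed.

Lemma cf_coloring_of_repeat (V : finType) (C : eqType) (E : {set {set V}}) (phi : V -> C) :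
  (forall e, e \in E ->
     (forall x, x \in e -> exists y, [/\ y \in e, y != x & phi y = phi x]) ->
     e = set0) -> cf_coloring E phi.
Proof.
move=> H; apply/forall_inP => e eE; apply/implyP; apply: contraNT.
rewrite negb_exists_in => /forall_inP xP; apply/eqP/H => // x /xP.
rewrite negb_forall_in => /exists_inP[y]; rewrite !inE negbK => /andP[yx ye] /eqP.
by exists y.
Qed.

Lemma cf_colorable_D2_upper (r n q : nat) : 0 < r -> 0 < q -> n <= q ^ r ->
  cf_colorable (D2 r n) (2 * r * q).+1.
Proof.
move=> r_gt0 q_gt0 nq.
have r2_gt0 : 0 < 2 * r by lia.
pose phi (x : 'I_n) : option ('I_(2 * r) * 'I_q) :=
  if val x is 0 then None else
  Some (Ordinal (ltn_pmod x r2_gt0),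
        Ordinal (ltn_pmod (x %/ r %/ q ^ (x %% r)) q_gt0)).
have phi0 x : (phi x == None) = (val x == 0) by rewrite /phi; case: (val x).
have phi_color x y : 0 < val x -> phi x = phi y ->
    digit_color r q x = digit_color r q y.
  rewrite /phi; case: (val x) => // x' _; case: (val y) => // y' [] e1 e2.
  by rewrite /digit_color /digit e1 e2.
have -> : (2 * r * q).+1 = #|{: option ('I_(2 * r) * 'I_q)}|.
  by rewrite card_option card_prod !card_ord.
apply: cf_coloring_colorable (phi) _; apply: cf_coloring_of_repeat => e.
case/imset2P => A B Apath; rewrite inE => /andP[Bpath AB] -> dup.
(* Vertex [0] alone has color [None], so it lies in no edge all of whose colors are repeated. *)
have e_gt0 x : x \in A :|: B -> 0 < val x.
  rewrite lt0n => /dup[y [_ yx exy]]; apply: contraNneq yx => x0.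
  apply/eqP/val_inj; rewrite x0; apply/eqP.
  by rewrite -phi0 exy phi0 x0.
have [|m mn AE] := path_avoiding0_interval r n A r_gt0 Apath.
  by move=> x xA; apply: e_gt0; rewrite inE xA.
have [|m' m'n BE] := path_avoiding0_interval r n B r_gt0 Bpath.
  by move=> x xB; apply: e_gt0; rewrite inE xB orbT.
(* A common start would lie in both of the disjoint paths. *)
suff mm' : m = m'.
  have mltn : m < n by lia.
  move/pred0P/(_ (Ordinal mltn)): AB; rewrite /= AE BE /= mm'; lia.
(* Within [A] residues modulo [2 * r] are distinct, so each color of [A] must recur in [B]. *)
apply: (digit_color_window_inj r q) => //; [lia|lia|move=> t tr].
have xn : m + t < n by lia.
have xA : Ordinal xn \in A by rewrite AE /=; lia.
have [|y [yAB yx /esym/phi_color yE]] := dup (Ordinal xn); first by rewrite inE xA.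
have {}yE := yE (e_gt0 _ _); rewrite inE xA in yE; have {}yE := yE isT.
case/setUP: yAB => [yA|yB].
- move: yA; rewrite AE => /andP[my yr]; case/negP: yx; apply/eqP/val_inj => /=.
  case: yE => + _; rewrite -(subnKC my).
  by move/(window_residue_inj r) => ->; rewrite ?subnKC // ltn_subLR.
- move: yB; rewrite BE => /andP[m'y yr]; exists (y - m').
    by rewrite ltn_subLR.
  by rewrite subnKC.
Qed.

From mathcomp Require Import all_order all_algebra.
From mathcomp Require Import all_classical all_reals all_analysis.

Import Order.TTheory GRing.Theory Num.Theory numFieldNormedType.Exports.
Local Open Scope classical_set_scope.
Local Open Scope ring_scope.

(** * Real estimates and asymptotics *)

Lemma powR_invn_natX (R : realType) (r q : nat) : (0 < r)%N ->
  (q ^ r)%:R `^ r%:R^-1 = q%:R :> R.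
Proof.
move=> r_gt0; rewrite natrX -powR_mulrn // -powRrM mulfV ?powRr1 //.
by rewrite pnatr_eq0 -lt0n.
Qed.

Lemma chi_CF_D2_lower (R : realType) (r n : nat) : (0 < r)%N -> (0 < n)%N ->
  n%:R `^ r%:R^-1 <= (2 * r)%:R * (chi_CF (D2 r n))%:R :> R.
Proof.
move=> r_gt0 n_gt0.
rewrite /chi_CF; case: ex_minnP => k kcol _.
have k_gt0 : (0 < k)%N.
  by case/existsP: kcol => phi _; case: k phi => // phi; case: (phi (Ordinal n_gt0)).
(* [n < (n %/ r).+1 * r <= 2 * r * k ^ r], and the factor [2 * r] is absorbed into the power so that
   an [r]-th root can be taken. *)
have nk : (n <= (2 * r * k) ^ r)%N.
  have := cf_colorable_D2_lower _ _ _ kcol => nk.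
  have kr : (0 < k ^ r)%N by rewrite expn_gt0 k_gt0.
  have nlt : (n < (n %/ r).+1 * r)%N by rewrite ltn_ceil.
  apply: (leq_trans (ltnW nlt)).
  apply: (@leq_trans (2 * r * k ^ r)).
    rewrite mulnAC leq_mul2r (leq_trans (_ : _ <= k ^ r + k ^ r)%N) ?orbT //.
      by rewrite -addn1 leq_add.
    by rewrite mul2n addnn.
  rewrite expnMn leq_mul2r; apply/orP; right.
  by rewrite -{1}(expn1 (2 * r)) leq_pexp2l // muln_gt0.
rewrite -natrM -(@powR_invn_natX R r (2 * r * k)) // ge0_ler_powR ?invr_ge0 ?nnegrE //.
by rewrite ler_nat.
Qed.

Lemma chi_CF_D2_upper (R : realType) (r n : nat) : (0 < r)%N -> (0 < n)%N ->
  (chi_CF (D2 r n))%:R <= (4 * r + 1)%:R * n%:R `^ r%:R^-1 :> R.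
Proof.
move=> r_gt0 n_gt0.
(* By minimality [q.-1 ^ r <= n], so [q] exceeds the [r]-th root of [n] by at most one. *)
have /ex_minnP[q nq qmin] : exists q, (n <= q ^ r)%N.
  exists n; by rewrite -{1}(expn1 n) leq_pexp2l.
have q_gt0 : (0 < q)%N.
  by rewrite lt0n; apply: contraTneq nq => ->; rewrite exp0n // -ltnNge.
have chi_le : (chi_CF (D2 r n) <= (2 * r * q).+1)%N.
  rewrite /chi_CF; case: ex_minnP => k _; apply.
  exact: cf_colorable_D2_upper.
have q1n : (q.-1 ^ r <= n)%N.
  rewrite leqNgt; apply/negP => /ltnW /qmin.
  by rewrite leqNgt prednK ?leqnn.
have q1 : q.-1%:R <= n%:R `^ r%:R^-1 :> R.
  rewrite -(@powR_invn_natX R r q.-1) // ge0_ler_powR ?invr_ge0 ?nnegrE //.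
  by rewrite ler_nat.
have n1 : 1 <= n%:R `^ r%:R^-1 :> R.
  have {1}<- : 1 `^ r%:R^-1 = 1 :> R by rewrite powR1.
  rewrite ge0_ler_powR ?invr_ge0 ?nnegrE //.
  by rewrite ler1n.
(* With [s] the [r]-th root of [n]: [2 * r * q + 1 <= 2 * r * (s + 1) + 1 <= (4 * r + 1) * s], as
   [1 <= s]. *)
apply: (@le_trans _ _ (2 * r * q).+1%:R); first by rewrite ler_nat.
apply: (@le_trans _ _ ((2 * r)%:R * (q.-1%:R + 1) + 1)).
  by rewrite natr1 prednK // -natrM natr1.
rewrite natrD mulrDl mul1r lerD //.
have -> : (4 * r = 2 * r * 2)%N by rewrite mulnAC.
by rewrite (natrM _ (2 * r)) -mulrA ler_wpM2l // mulr_natl mulr2n lerD.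
Qed.

Theorem theorem1p6 (R : realType) (r : nat) (r_gt0 : (0 < r)%N) :
  (fun n : nat => (chi_CF (D2 r n))%:R : R^o) \is
    'Theta_\oo (fun n : nat => n%:R `^ (r%:R^-1) : R^o).
Proof.
apply/asboolP.
(* The constants come from the two preceding bounds, which apply once [n] is positive. *)
exists ((2 * r)%:R^-1, (4 * r + 1)%:R) => /=.
  by rewrite invr_gt0 !ltr0n addn1 muln_gt0 r_gt0.
near=> n.
have n_gt0 : (0 < n)%N by near: n; exists 1%N.
rewrite !ger0_norm ?powR_ge0 //; split.
  rewrite ler_pdivrMl ?ltr0n ?muln_gt0 ?r_gt0 //; exact: chi_CF_D2_lower.
exact: chi_CF_D2_upper.
Unshelve. all: by end_near. Qed.
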